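(* The series $\mathcal{V}_d(z,q)$ and $\mathcal{X}_d(z,q)$ belong to $\mathscr{T}_{z,q}^2$. In particular, for all integers $m,n\ge 0$: $V_d(m,n)>V_d(m+2,n)$ provided $V_d(m,n)\ne 0$, and $X_d(m,n)>X_d(m+2,n)$ provided $X_d(m,n)\ne0$.
   Context: $(a;q)_n=\prod_{0\le j<n}(1-aq^j)$ for $n\in\mathbb{N}_0\cup\{\infty\}$ and $(a,b;q)_n=(a;q)_n(b;q)_n$. Define $V_d(m,n),X_d(m,n)$ by $$\mathcal{V}_d(z,q)=\sum_{n\ge0}\sum_{m\in\mathbb{Z}}V_d(m,n)z^mq^n=\sum_{n\ge0}q^n(-zq^{n+1},-z^{-1}q^{n+1};q)_\infty,\quad \mathcal{X}_d(z,q)=\sum_{n\ge0}\sum_{m\in\mathbb{Z}}X_d(m,n)z^mq^n=\sum_{n\ge0}q^{n+1}(-zq,-z^{-1}q;q)_n$$ (these count strictly concave, resp. strictly convex, compositions of $n$ by rank $m$). For $\nu\in\{1,2\}$, $\mathscr{T}_z^\nu$ is the set of Laurent polynomials $\sum_ic_iz^i$ with real $c_i\ge0$, $c_{-i}=c_i$, $c_{r+\ell\nu}\ge c_{r+(\ell+1)\nu}$ for all $0\le r<\nu$, $\ell\ge0$, and $c_{r+\ell\nu}>c_{r+(\ell+1)\nu}$ whenever $c_{r+\ell\nu}>0$. A series $\sum_nC_n(z)q^n$ with Laurent polynomial coefficients lies in $\mathscr{T}_{z,q}^\nu$ if every $C_n(z)\in\mathscr{T}_z^\nu$. *)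

(* Defs.v *)
From HB Require Import structures.
From mathcomp Require Import all_boot all_order all_algebra.
From mathcomp Require Import finmap.
From mathcomp Require Import boolp classical_sets reals.

Set Implicit Arguments.
Unset Strict Implicit.
Unset Printing Implicit Defensive.

Import Order.TTheory GRing.Theory Num.Theory.
Local Open Scope fset_scope.
Local Open Scope ring_scope.

Record laurent (R : comNzRingType) :=
  Laurent { laurent_val : {fsfun int -> R with 0} }.

Definition lcoef (R : comNzRingType) (f : laurent R) (i : int) : R :=
  laurent_val f i.

HB.instance Definition _ (R : comNzRingType) := [isNew for @laurent_val R].
HB.instance Definition _ (R : comNzRingType) := [Choice of laurent R by <:].

Section LaurentRing.
Variable R : comNzRingType.
Implicit Types f g h : laurent R.

Definition lsupp f : {fset int} := finsupp (laurent_val f).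

Lemma laurentP f g : (forall i, lcoef f i = lcoef g i) <-> f = g.
Proof.
by case: f g => [f] [g]; split=> [fg|->//]; congr Laurent; apply/fsfunP/fg.
Qed.

Lemma lcoef_out f i : i \notin lsupp f -> lcoef f i = 0.
Proof. exact: fsfun_dflt. Qed.

(* z ^ i, for an integer exponent i *)
Definition zpow (i : int) : laurent R := Laurent [fsfun k in [fset i] => 1].

Definition laurent0 : laurent R := Laurent [fsfun].
Definition laurent_opp f := Laurent [fsfun i in lsupp f => - lcoef f i].
Definition laurent_add f g :=
  Laurent [fsfun i in lsupp f `|` lsupp g => lcoef f i + lcoef g i].
Definition laurent_mul f g :=
  Laurent [fsfun k in [fset i + j | i in lsupp f, j in lsupp g] =>
             \sum_(i <- lsupp f) lcoef f i * lcoef g (k - i)].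

Lemma lcoef_zpow i k : lcoef (zpow i) k = (k == i)%:R.
Proof. by rewrite /lcoef fsfun_fun inE; case: eqP. Qed.

Let lcoef0_ k : lcoef laurent0 k = 0.
Proof. by rewrite /lcoef fsfun0E. Qed.

Let lcoefN_ f k : lcoef (laurent_opp f) k = - lcoef f k.
Proof.
by rewrite {1}/lcoef fsfun_fun; case: ifPn => // /lcoef_out ->; rewrite oppr0.
Qed.

Let lcoefD_ f g k : lcoef (laurent_add f g) k = lcoef f k + lcoef g k.
Proof.
rewrite {1}/lcoef fsfun_fun inE; case: ifPn => //.
by rewrite negb_or => /andP[/lcoef_out-> /lcoef_out->]; rewrite addr0.
Qed.

Let lcoefM_ f g k : lcoef (laurent_mul f g) k =
  \sum_(i <- lsupp f) lcoef f i * lcoef g (k - i).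
Proof.
rewrite {1}/lcoef fsfun_fun; case: ifPn => // knotin.
rewrite big_seq big1 // => i if_; rewrite [lcoef g _]lcoef_out ?mulr0 //.
apply: contra knotin => kg; apply/imfset2P; exists i => //.
by exists (k - i) => //; rewrite addrC subrK.
Qed.

Let lcoefMw f g k (S : {fset int}) : lsupp f `<=` S ->
  lcoef (laurent_mul f g) k = \sum_(i <- S) lcoef f i * lcoef g (k - i).
Proof.
move=> fS; rewrite lcoefM_ (big_fset_incl _ fS) //.
by move=> i _ /lcoef_out ->; rewrite mul0r.
Qed.

Let laddA : associative laurent_add.
Proof. by move=> f g h; apply/laurentP => k; rewrite !lcoefD_ addrA. Qed.
Let laddC : commutative laurent_add.
Proof. by move=> f g; apply/laurentP => k; rewrite !lcoefD_ addrC. Qed.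
Let ladd0 : left_id laurent0 laurent_add.
Proof. by move=> f; apply/laurentP => k; rewrite lcoefD_ lcoef0_ add0r. Qed.
Let laddN : left_inverse laurent0 laurent_opp laurent_add.
Proof.
by move=> f; apply/laurentP => k; rewrite lcoefD_ lcoefN_ lcoef0_ addNr.
Qed.

HB.instance Definition _ :=
  GRing.isZmodule.Build (laurent R) laddA laddC ladd0 laddN.

Let lcoefM2 f g k : lcoef (laurent_mul f g) k =
  \sum_(i <- lsupp f) \sum_(j <- lsupp g | i + j == k) lcoef f i * lcoef g j.
Proof.
rewrite lcoefM_; apply: eq_bigr => i _.
have eqk j : (i + j == k) = (j == k - i) by rewrite [RHS]eq_sym subr_eq addrC eq_sym.
under eq_bigl do rewrite eqk.
have [kg|kg] := boolP ((k - i) \in lsupp g).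
  by rewrite -big_filter filter_pred1_uniq ?big_seq1 ?fset_uniq.
rewrite (lcoef_out kg) mulr0 big_seq_cond big1 // => j /andP[jg /eqP jk].
by move: kg; rewrite -jk jg.
Qed.

Let lmulC : commutative laurent_mul.
Proof.
move=> f g; apply/laurentP => k; rewrite !lcoefM2.
under eq_bigr do rewrite big_mkcond.
rewrite exchange_big; apply: eq_bigr => j _; rewrite [RHS]big_mkcond.
by apply: eq_bigr => i _; rewrite addrC mulrC.
Qed.

Let lmulA : associative laurent_mul.
Proof.
move=> f g h; rewrite [laurent_mul g h]lmulC [RHS]lmulC.
apply/laurentP => k; rewrite !lcoefM_.
under eq_bigr do rewrite lcoefM_ mulr_sumr.
under [RHS]eq_bigr do rewrite lcoefM_ mulr_sumr.
rewrite exchange_big; apply: eq_bigr => j _; apply: eq_bigr => i _.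
by rewrite mulrCA addrAC.
Qed.

Let lmul1 : left_id (zpow 0) laurent_mul.
Proof.
move=> f; apply/laurentP => k; rewrite (@lcoefMw _ _ _ [fset 0]).
  by rewrite big_seq_fset1 lcoef_zpow eqxx mul1r subr0.
apply/fsubsetP => i; rewrite mem_finsupp inE -[laurent_val _ _]/(lcoef _ i).
by rewrite lcoef_zpow; case: (i == 0) => //; rewrite eqxx.
Qed.

Let lmulDl : left_distributive laurent_mul +%R.
Proof.
move=> f g h; apply/laurentP => k; rewrite lcoefD_.
pose S := lsupp (f + g) `|` (lsupp f `|` lsupp g).
have fS : lsupp f `<=` S by apply/fsubsetP => i; rewrite !inE => ->; rewrite orbT.
have gS : lsupp g `<=` S by apply/fsubsetP => i; rewrite !inE => ->; rewrite !orbT.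
rewrite (@lcoefMw (f + g) _ _ S) ?fsubsetUl // (lcoefMw _ _ fS) (lcoefMw _ _ gS).
by rewrite -big_split; apply: eq_bigr => i _; rewrite lcoefD_ mulrDl.
Qed.

Let lone_neq0 : zpow 0 != 0.
Proof.
apply/eqP => /laurentP/(_ 0); rewrite lcoef_zpow eqxx lcoef0_.
by apply/eqP; rewrite oner_eq0.
Qed.

HB.instance Definition _ := GRing.Zmodule_isComNzRing.Build (laurent R)
  lmulA lmulC lmul1 lmulDl lone_neq0.

Lemma lcoef0 k : lcoef (0 : laurent R) k = 0. Proof. exact: lcoef0_. Qed.
Lemma lcoefN f k : lcoef (- f) k = - lcoef f k. Proof. exact: lcoefN_. Qed.
Lemma lcoefD f g k : lcoef (f + g) k = lcoef f k + lcoef g k.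
Proof. exact: lcoefD_. Qed.
Lemma lcoefM f g k :
  lcoef (f * g) k = \sum_(i <- lsupp f) lcoef f i * lcoef g (k - i).
Proof. exact: lcoefM_. Qed.

Lemma zpow0 : zpow 0 = 1. Proof. by []. Qed.

Lemma lcoef_zpowM i f k : lcoef (zpow i * f) k = lcoef f (k - i).
Proof.
rewrite [LHS](@lcoefMw _ _ _ [fset i]).
  by rewrite big_seq_fset1 lcoef_zpow eqxx mul1r.
apply/fsubsetP => j; rewrite mem_finsupp inE -[laurent_val _ _]/(lcoef _ j).
by rewrite lcoef_zpow; case: (j == i) => //; rewrite eqxx.
Qed.

Lemma zpowD i j : zpow (i + j) = zpow i * zpow j.
Proof.
apply/laurentP => k; rewrite lcoef_zpowM !lcoef_zpow.
by rewrite subr_eq [j + i]addrC.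
Qed.

End LaurentRing.

Record fps (L : comNzRingType) := FPS { fps_coef : nat -> L }.

HB.instance Definition _ (L : comNzRingType) := gen_eqMixin (fps L).
HB.instance Definition _ (L : comNzRingType) := gen_choiceMixin (fps L).

Section FpsRing.
Variable L : comNzRingType.
Implicit Types f g h : fps L.

Lemma fpsP f g : (forall n, fps_coef f n = fps_coef g n) <-> f = g.
Proof.
by case: f g => [f] [g]; split=> [fg|->//]; congr FPS; apply/funext/fg.
Qed.

Definition fpsC (c : L) : fps L := FPS (fun n => if n == 0%N then c else 0).
Definition fpsq : fps L := FPS (fun n => (n == 1%N)%:R).

Definition fps_opp f := FPS (fun n => - fps_coef f n).
Definition fps_add f g := FPS (fun n => fps_coef f n + fps_coef g n).
Definition fps_mul f g :=
  FPS (fun n => \sum_(i < n.+1) fps_coef f i * fps_coef g (n - i)).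

Let faddA : associative fps_add.
Proof. by move=> f g h; apply/fpsP => n /=; rewrite addrA. Qed.
Let faddC : commutative fps_add.
Proof. by move=> f g; apply/fpsP => n /=; rewrite addrC. Qed.
Let fadd0 : left_id (fpsC 0) fps_add.
Proof. by move=> f; apply/fpsP => n /=; case: eqP; rewrite add0r. Qed.
Let faddN : left_inverse (fpsC 0) fps_opp fps_add.
Proof. by move=> f; apply/fpsP => n /=; case: eqP; rewrite addNr. Qed.

HB.instance Definition _ :=
  GRing.isZmodule.Build (fps L) faddA faddC fadd0 faddN.

Definition fps_trunc N f : {poly L} := \poly_(i < N) fps_coef f i.

Let fmul_trunc N f g n : (n < N)%N ->
  fps_coef (fps_mul f g) n = (fps_trunc N f * fps_trunc N g)`_n.
Proof.
move=> nN; rewrite coefM /=; apply: eq_bigr => i _; rewrite !coef_poly.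
by rewrite (leq_ltn_trans _ nN) ?(leq_ltn_trans _ nN) ?leq_subr // -ltnS ltn_ord.
Qed.

Let fmulC : commutative fps_mul.
Proof.
by move=> f g; apply/fpsP => n; rewrite !(@fmul_trunc n.+1) // mulrC.
Qed.

Let fmulA : associative fps_mul.
Proof.
move=> f g h; apply/fpsP => n.
pose T := fps_trunc n.+1.
transitivity ((T f * T g * T h)`_n); last first.
  rewrite coefM; apply: eq_bigr => i _; rewrite (@fmul_trunc n.+1) //.
  by rewrite /T [(fps_trunc _ h)`_ _]coef_poly ltnS leq_subr.
rewrite -mulrA coefM; apply: eq_bigr => i _.
by rewrite (@fmul_trunc n.+1) ?ltnS ?leq_subr // /T coef_poly ltn_ord.
Qed.

Let fmul1 : left_id (fpsC 1) fps_mul.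
Proof.
move=> f; apply/fpsP => n /=; rewrite big_ord_recl /= mul1r subn0 big1 ?addr0 //.
by move=> i _; rewrite mul0r.
Qed.

Let fmulDl : left_distributive fps_mul +%R.
Proof.
move=> f g h; apply/fpsP => n /=; rewrite -big_split.
by apply: eq_bigr => i _; rewrite mulrDl.
Qed.

Let fone_neq0 : fpsC 1 != 0.
Proof.
by apply/eqP => /fpsP/(_ 0%N) /= /eqP; rewrite oner_eq0.
Qed.

HB.instance Definition _ := GRing.Zmodule_isComNzRing.Build (fps L)
  fmulA fmulC fmul1 fmulDl fone_neq0.

Lemma fps_coef0 n : fps_coef (0 : fps L) n = 0.
Proof. by case: n. Qed.
Lemma fps_coef1 n : fps_coef (1 : fps L) n = (n == 0%N)%:R.
Proof. by case: n. Qed.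
Lemma fps_coefN f n : fps_coef (- f) n = - fps_coef f n.
Proof. by []. Qed.
Lemma fps_coefD f g n : fps_coef (f + g) n = fps_coef f n + fps_coef g n.
Proof. by []. Qed.
Lemma fps_coefM f g n :
  fps_coef (f * g) n = \sum_(i < n.+1) fps_coef f i * fps_coef g (n - i).
Proof. by []. Qed.

Lemma fps_coef_qXM k f n :
  fps_coef (fpsq ^+ k * f) n = if (n < k)%N then 0 else fps_coef f (n - k).
Proof.
have qE g m : fps_coef (fpsq * g) m = if m is m'.+1 then fps_coef g m' else 0.
  rewrite fps_coefM; case: m => [|m]; first by rewrite big_ord1 mul0r.
  rewrite big_ord_recl mul0r add0r big_ord_recl mul1r subSS subn0 big1 ?addr0 //.
  by move=> i _; rewrite mul0r.
elim: k n => [|k IH] n; first by rewrite expr0 mul1r subn0.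
by rewrite exprS -mulrA qE; case: n => [//|n]; rewrite IH.
Qed.

(* Convergence coefficient by coefficient, the coefficient ring L being
   discrete. *)
Definition fps_cvg (u : nat -> fps L) f :=
  forall k, exists N, forall n, (N <= n)%N -> fps_coef (u n) k = fps_coef f k.

(* The limit of u, and the junk value 0 if u does not converge. *)
Definition fps_lim (u : nat -> fps L) : fps L :=
  xget 0 [set f | fps_cvg u f]%classic.

Lemma fps_cvg_unique u f g : fps_cvg u f -> fps_cvg u g -> f = g.
Proof.
move=> uf ug; apply/fpsP => k; have [M uM] := uf k; have [N uN] := ug k.
by rewrite -(uM (maxn M N)) ?leq_maxl // uN ?leq_maxr.
Qed.

Lemma fps_limE u f : fps_cvg u f -> fps_lim u = f.
Proof.
move=> uf; apply: (fps_cvg_unique _ uf).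
by apply: (@xgetPex _ 0 [set f | fps_cvg u f]%classic); exists f.
Qed.

Definition fps_series (F : nat -> fps L) : fps L :=
  fps_lim (fun N => \sum_(n < N) F n).

Lemma fps_seriesP (F : nat -> fps L) :
  (forall k n, (k < n)%N -> fps_coef (F n) k = 0) ->
  fps_cvg (fun N => \sum_(n < N) F n) (fps_series F).
Proof.
move=> F0; pose f := FPS (fun k => fps_coef (\sum_(n < k.+1) F n) k).
suff cf : fps_cvg (fun N => \sum_(n < N) F n) f by rewrite /fps_series (fps_limE cf).
move=> k; exists k.+1 => n /subnK <-; elim: (n - _)%N => [//|m IH].
by rewrite addSn big_ord_recr fps_coefD IH F0 ?addr0 // addnS ltnS leq_addl.
Qed.

Definition qpoch (a : fps L) (n : nat) : fps L :=
  \prod_(j < n) (1 - a * fpsq ^+ j).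

Definition qpoch_inf (a : fps L) : fps L := fps_lim (qpoch a).

(* (a, b; q)_n and (a, b; q)_oo *)
Definition qpoch2 (a b : fps L) (n : nat) : fps L := qpoch a n * qpoch b n.

Definition qpoch2_inf (a b : fps L) : fps L := qpoch_inf a * qpoch_inf b.

Lemma qpoch_infP a : fps_cvg (qpoch a) (qpoch_inf a).
Proof.
suff cf : fps_cvg (qpoch a) (FPS (fun k => fps_coef (qpoch a k.+1) k)).
  by rewrite /qpoch_inf (fps_limE cf).
have qpochS n : qpoch a n.+1 = qpoch a n - fpsq ^+ n * (qpoch a n * a).
  by rewrite /qpoch big_ord_recr /= mulrBr mulr1; congr (_ - _); rewrite [RHS]mulrC -mulrA.
move=> k; exists k.+1 => n /subnK <-; elim: (n - _)%N => [//|m IH].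
rewrite addSn qpochS fps_coefD fps_coefN IH fps_coef_qXM.
by rewrite addnS ltnS leq_addl subr0.
Qed.

End FpsRing.

Arguments fpsq {L}.

Section GeneratingFunctions.
Variable R : comNzRingType.

Definition zfps (i : int) : fps (laurent R) := fpsC (zpow R i).

Definition Vterm (n : nat) : fps (laurent R) :=
  fpsq ^+ n *
  qpoch2_inf (- zfps 1 * fpsq ^+ n.+1) (- zfps (-1) * fpsq ^+ n.+1).

Definition Xterm (n : nat) : fps (laurent R) :=
  fpsq ^+ n.+1 * qpoch2 (- zfps 1 * fpsq) (- zfps (-1) * fpsq) n.

Definition Vdser : fps (laurent R) := fps_series Vterm.
Definition Xdser : fps (laurent R) := fps_series Xterm.

Lemma Vdser_cvg : fps_cvg (fun N => \sum_(n < N) Vterm n) Vdser.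
Proof. by apply: fps_seriesP => k n kn; rewrite fps_coef_qXM kn. Qed.

Lemma Xdser_cvg : fps_cvg (fun N => \sum_(n < N) Xterm n) Xdser.
Proof. by apply: fps_seriesP => k n kn; rewrite fps_coef_qXM ltnS ltnW. Qed.

Definition Vd (m : int) (n : nat) : R := lcoef (fps_coef Vdser n) m.
Definition Xd (m : int) (n : nat) : R := lcoef (fps_coef Xdser n) m.

End GeneratingFunctions.

Section Unimodal.
Variable R : realType.

Definition Tz (nu : nat) (c : laurent R) : Prop :=
  [/\ forall i : int, 0 <= lcoef c i,
      forall i : int, lcoef c (- i) = lcoef c i,
      forall r l : nat, (r < nu)%N ->
        lcoef c (r + l * nu)%N >= lcoef c (r + l.+1 * nu)%N
    & forall r l : nat, (r < nu)%N -> lcoef c (r + l * nu)%N > 0 ->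
        lcoef c (r + l * nu)%N > lcoef c (r + l.+1 * nu)%N].

Definition Tzq (nu : nat) (C : fps (laurent R)) : Prop :=
  forall n : nat, Tz nu (fps_coef C n).

End Unimodal.

(* Main.v *)
Require Import Defs.
From mathcomp Require Import all_boot all_order all_algebra.
From mathcomp Require Import reals.
From mathcomp Require Import zify ring lra.
Import Order.TTheory GRing.Theory Num.Theory.
Local Open Scope ring_scope.

(**
Pairing the factors in z and 1/z gives
  (1 + z q^k) (1 + z^-1 q^k) = 1 + q^(2k) + q^k (z + z^-1),
so both series are built from 1 by sums, shifts in q, coefficientwise limits
and multiplication by z + z^-1.  Each of these operations preserves the class:
if d = (z + z^-1) c then
  d_i - d_(i+2) = (c_(i-1) - c_(i+1)) + (c_(i+1) - c_(i+3)),
where for i = 0 the first bracket vanishes by symmetry. *)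

Section FormalPowerSeries.
Variable L : comNzRingType.
Implicit Types (f g : fps L) (u v : nat -> fps L).

Lemma fps_cvg_upto u f k : fps_cvg u f ->
  exists N, forall n i, (N <= n)%N -> (i <= k)%N ->
    fps_coef (u n) i = fps_coef f i.
Proof.
move=> uf; elim: k => [|k [N uN]].
  by have [N uN] := uf 0%N; exists N => n i Nn; rewrite leqn0 => /eqP->; apply: uN.
have [M uM] := uf k.+1; exists (maxn M N) => n i; rewrite geq_max => /andP[Mn Nn].
by rewrite leq_eqVlt => /predU1P[->|]; [apply: uM | apply: uN].
Qed.

Lemma fps_cvgM u v f g : fps_cvg u f -> fps_cvg v g ->
  fps_cvg (fun n => u n * v n) (f * g).
Proof.
move=> uf vg k; have [M uM] := fps_cvg_upto _ _ k uf.
have [N vN] := fps_cvg_upto _ _ k vg; exists (maxn M N) => n.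
rewrite geq_max => /andP[Mn Nn]; rewrite !fps_coefM; apply: eq_bigr => i _.
by rewrite uM ?vN // ?leq_subr // -ltnS.
Qed.

Lemma fpsCD (a b : L) : fpsC (a + b) = fpsC a + fpsC b.
Proof. by apply/fpsP => n; rewrite fps_coefD /=; case: eqP; rewrite ?addr0. Qed.

Lemma fps_coefCM (c : L) f n : fps_coef (fpsC c * f) n = c * fps_coef f n.
Proof.
by rewrite fps_coefM big_ord_recl subn0 big1 ?addr0 // => i _; rewrite mul0r.
Qed.

Lemma fpsCM (a b : L) : fpsC (a * b) = fpsC a * fpsC b.
Proof.
by apply/fpsP => n; rewrite fps_coefCM /=; case: eqP; rewrite ?mulr0.
Qed.

End FormalPowerSeries.

Section SymmetricUnimodal.
Variable R : realType.
Implicit Types (c d : laurent R) (C D : fps (laurent R)).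

(** Writing [m] as [r + 2 l] with [r] its parity merges the two indices into a single step from [m]
    to [m + 2]. *)
Lemma Tz2P c : Tz 2 c <->
  [/\ forall i : int, 0 <= lcoef c i,
      forall i : int, lcoef c (- i) = lcoef c i,
      forall m : nat, lcoef c (m + 2)%N <= lcoef c m
    & forall m : nat, 0 < lcoef c m -> lcoef c (m + 2)%N < lcoef c m].
Proof.
have next (r l : nat) : (r + l.+1 * 2 = r + l * 2 + 2)%N by lia.
have parity (m : nat) : (m = m %% 2 + m %/ 2 * 2)%N by lia.
split=> -[c0 cN cle clt]; split=> //.
- by move=> m; rewrite (parity m) -next cle ?ltn_pmod.
- by move=> m; rewrite (parity m) -next => /clt; apply; rewrite ltn_pmod.
- by move=> r l _; rewrite next.
- by move=> r l _ /clt; rewrite next.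
Qed.

Lemma Tz2_0 : Tz 2 (0 : laurent R).
Proof. by apply/Tz2P; split=> [i|i|m|m]; rewrite !lcoef0 ?ltxx. Qed.

Lemma Tz2_1 : Tz 2 (1 : laurent R).
Proof.
apply/Tz2P; rewrite -zpow0; split=> [i|i|m|m]; rewrite !lcoef_zpow.
- exact: ler0n.
- by rewrite oppr_eq0.
- by rewrite addn2 ler0n.
- by rewrite addn2.
Qed.

Lemma Tz2D c d : Tz 2 c -> Tz 2 d -> Tz 2 (c + d).
Proof.
move=> /Tz2P[c0 cN cle clt] /Tz2P[d0 dN dle dlt]; apply/Tz2P.
split=> [i|i|m|m]; rewrite !lcoefD.
- by rewrite addr_ge0.
- by rewrite cN dN.
- by rewrite lerD.
(* A positive sum has a positive summand, which supplies the strict inequality; the other supplies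
   the weak one. *)
move=> cd; have [/clt cm|] := ltP 0 (lcoef c m); first exact: ltr_leD.
by move=> cm; apply: ler_ltD => //; apply: dlt; lra.
Qed.

Lemma Tz2_zpow1M c : Tz 2 c -> Tz 2 ((zpow R 1 + zpow R (-1)) * c).
Proof.
move=> /Tz2P[c0 cN cle clt]; apply/Tz2P.
have dE k : lcoef ((zpow R 1 + zpow R (-1)) * c) k =
    lcoef c (k - 1) + lcoef c (k + 1).
  by rewrite mulrDl lcoefD !lcoef_zpowM opprK.
have down (m : nat) : (m + 2)%N%:Z - 1 = m.+1%:Z by lia.
have up (m : nat) : m%:Z + 1 = m.+1%:Z by lia.
have up2 (m : nat) : (m + 2)%N%:Z + 1 = (m.+1 + 2)%N%:Z by lia.
have pred0 : lcoef c (0%N%:Z - 1) = lcoef c 1%N by rewrite sub0r cN.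
have predS (m : nat) : m.+1%:Z - 1 = m%:Z by lia.
split=> [i|i|m|m]; rewrite !dE.
- by rewrite addr_ge0.
- rewrite addrC -[lcoef c (i - 1)]cN -[lcoef c (i + 1)]cN.
  by congr (lcoef c _ + lcoef c _); ring.
- rewrite down up2 up; case: m => [|m]; first by rewrite pred0 lerD.
  by rewrite predS lerD // -[m.+2]addn2.
rewrite down up2 up; case: m => [|m].
  (* Here d_0 = 2 c_1 > 0, so the second bracket c_1 - c_3 is strictly positive. *)
  by rewrite pred0 => c1; apply: ler_ltD => //; apply: clt; lra.
(* Now c_m + c_(m+2) > 0 and c_(m+2) <= c_m force c_m > 0, so the first bracket is strictly
   positive. *)
rewrite predS -[m.+2]addn2 => cm; apply: ltr_leD => //; apply: clt.
by have := cle m; lra.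
Qed.

Lemma Tzq2_1 : Tzq 2 (1 : fps (laurent R)).
Proof.
by case=> [|n]; rewrite fps_coef1; [exact: Tz2_1 | exact: Tz2_0].
Qed.

Lemma Tzq2D C D : Tzq 2 C -> Tzq 2 D -> Tzq 2 (C + D).
Proof. by move=> TC TD n; rewrite fps_coefD; apply: Tz2D. Qed.

Lemma Tzq2_sum N (F : nat -> fps (laurent R)) :
  (forall n, Tzq 2 (F n)) -> Tzq 2 (\sum_(n < N) F n).
Proof.
move=> TF; apply: big_ind => //; last exact: Tzq2D.
by move=> n; rewrite fps_coef0; apply: Tz2_0.
Qed.

Lemma Tzq2_qXM k C : Tzq 2 C -> Tzq 2 (fpsq ^+ k * C).
Proof.
by move=> TC n; rewrite fps_coef_qXM; case: ifP => _; [exact: Tz2_0|].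
Qed.

(** Each coefficient of the limit is attained at a finite stage, so strict inequalities survive. *)
Lemma Tzq2_cvg (u : nat -> fps (laurent R)) C :
  fps_cvg u C -> (forall n, Tzq 2 (u n)) -> Tzq 2 C.
Proof. by move=> uC Tu k; have [N uN] := uC k; rewrite -(uN N) //; apply: Tu. Qed.

Lemma pair_factorE k :
  (1 - - zfps R 1 * fpsq ^+ k) * (1 - - zfps R (-1) * fpsq ^+ k) =
  1 + fpsq ^+ (k + k) + fpsq ^+ k * fpsC (zpow R 1 + zpow R (-1)).
Proof.
have : zfps R 1 * zfps R (-1) = 1 by rewrite -fpsCM -zpowD subrr.
rewrite fpsCD -/(zfps R 1) -/(zfps R (-1)) exprD.
(* What remains is a polynomial identity modulo x y = 1. *)
move: (zfps R 1) (zfps R (-1)) (fpsq ^+ k) => x y s xy.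
transitivity (1 + x * y * (s * s) + s * (x + y)); first by ring.
by rewrite xy mul1r.
Qed.

Lemma Tzq2_pair_factorM k C : Tzq 2 C ->
  Tzq 2 ((1 - - zfps R 1 * fpsq ^+ k) * (1 - - zfps R (-1) * fpsq ^+ k) * C).
Proof.
move=> TC; rewrite pair_factorE !mulrDl mul1r -mulrA.
do 2?[apply: Tzq2D => //]; apply: Tzq2_qXM => // n.
by rewrite fps_coefCM; apply: Tz2_zpow1M.
Qed.

(** The factors of equal index are multiplied first, since a factor in z or 1/z alone is not
    symmetric. *)
Lemma Tzq2_qpoch2 k n :
  Tzq 2 (qpoch2 (- zfps R 1 * fpsq ^+ k) (- zfps R (-1) * fpsq ^+ k) n).
Proof.
rewrite /qpoch2 /qpoch -big_split /=.
elim/big_rec: _ => [|j C _ TC]; first exact: Tzq2_1.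
by rewrite -!(mulrA (- _)) -exprD; apply: Tzq2_pair_factorM.
Qed.

Lemma Tzq2_Vdser : Tzq 2 (Vdser R).
Proof.
apply: Tzq2_cvg (Vdser_cvg R) _ => N; apply: Tzq2_sum => n; apply: Tzq2_qXM.
(* Pairing takes place in the finite products, whose limit is the product of the two infinite
   ones. *)
exact: Tzq2_cvg (fps_cvgM _ _ _ _ _ (qpoch_infP _) (qpoch_infP _))
  (Tzq2_qpoch2 n.+1).
Qed.

Lemma Tzq2_Xdser : Tzq 2 (Xdser R).
Proof.
apply: Tzq2_cvg (Xdser_cvg R) _ => N; apply: Tzq2_sum => n; apply: Tzq2_qXM.
by have := @Tzq2_qpoch2 1 n; rewrite expr1.
Qed.

(** Nonnegativity turns a nonzero coefficient into a positive one. *)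
Lemma Tz2_lt c (m : nat) : Tz 2 c ->
  lcoef c m != 0 -> lcoef c (m + 2)%N < lcoef c m.
Proof. by move=> /Tz2P[c0 _ _ clt] cm; apply: clt; rewrite lt0r cm c0. Qed.

End SymmetricUnimodal.

Theorem theorem4p3 (R : realType) :
  [/\ Tzq 2 (Vdser R),
      Tzq 2 (Xdser R),
      forall m n : nat, Vd R m n != 0 -> Vd R m n > Vd R (m + 2)%N n
    & forall m n : nat, Xd R m n != 0 -> Xd R m n > Xd R (m + 2)%N n].
Proof.
split; [exact: Tzq2_Vdser | exact: Tzq2_Xdser | |] => m n.
- exact/Tz2_lt/Tzq2_Vdser.
- exact/Tz2_lt/Tzq2_Xdser.
Qed.
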